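(* Let $\Gamma$ be a distance-regular graph with valency $k\geq 3$ and diameter $D\in\{4,5\}$. Then either $c_2\leq \frac{1}{3}k$, or one of the following holds: (i) $D=4$ and $\Gamma$ is a Hadamard graph; (ii) $D=5$ and $\Gamma$ is the $5$-cube.
   Context: A connected graph $\Gamma$ with diameter $D$ is distance-regular if there are integers $b_i,c_i$ ($0\le i\le D$) such that for any two vertices $x,y$ at distance $i$, exactly $c_i$ neighbours of $y$ are at distance $i-1$ from $x$ and exactly $b_i$ neighbours of $y$ are at distance $i+1$ from $x$ (with $b_D=c_0=0$); its valency is $k=b_0$. Thus $c_2$ is the number of common neighbours of two vertices at distance $2$. A Hadamard graph is a distance-regular graph with intersection array $\{b_0,b_1,b_2,b_3;c_1,c_2,c_3,c_4\}=\{k,k-1,\frac{k}{2},1;1,\frac{k}{2},k-1,k\}$. The $5$-cube is the graph on $\{0,1\}^5$ with two vectors adjacent iff they differ in exactly one coordinate. *)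

(* Defs.v *)
From mathcomp Require Import all_boot.

Set Implicit Arguments.
Unset Strict Implicit.
Unset Printing Implicit Defensive.

Section Graphs.

Variable T : finType.
Implicit Types (e : rel T) (x y z : T) (b c : nat -> nat).

Definition simple_graph e : Prop := symmetric e /\ irreflexive e.

Definition connected_graph e : Prop := forall x y, connect e x y.

Definition walk e n x y : bool :=
  [exists p : n.-tuple T, path e x p && (last x p == y)].

(* A shortest path has fewer than #|T| edges, so the bounded search below is
   exhaustive; the junk value #|T| is returned when x and y are not connected.
   See gdist_walk and gdist_min. *)
Definition gdist e x y : nat := find (fun n => walk e n x y) (iota 0 #|T|).

Definition diameter e : nat := \max_(x : T) \max_(y : T) gdist e x y.

(* The values of b and c beyond the diameter D are unconstrained. The condition
   (gdist e x z).+1 == gdist e x y says that d(x, z) = d(x, y) - 1 without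
   truncated subtraction. *)
Definition distance_regular e (D : nat) b c : Prop :=
  [/\ simple_graph e, connected_graph e, diameter e = D,
      b D = 0 /\ c 0 = 0
    & forall x y,
        #|[set z | e y z & (gdist e x z).+1 == gdist e x y]|
          = c (gdist e x y)
     /\ #|[set z | e y z & gdist e x z == (gdist e x y).+1]|
          = b (gdist e x y)].

(* ~~ odd k makes k./2 the exact half of k. *)
Definition hadamard_graph e : Prop :=
  exists k b c,
    [/\ distance_regular e 4 b c, ~~ odd k,
        [:: b 0; b 1; b 2; b 3] = [:: k; k.-1; k./2; 1]
      & [:: c 1; c 2; c 3; c 4] = [:: 1; k./2; k.-1; k]].

Lemma walkP e n x y :
  reflect (exists p : seq T, [/\ size p = n, path e x p & last x p = y])
          (walk e n x y).
Proof.
apply: (iffP existsP) => [[p /andP[ep /eqP lp]]|[p [/eqP sp ep lp]]].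
  by exists p; rewrite size_tuple.
by exists (Tuple sp); rewrite /= ep lp eqxx.
Qed.

Lemma has_walk e x y :
  connect e x y -> has (fun n => walk e n x y) (iota 0 #|T|).
Proof.
case/connectP=> p ep ->; case/shortenP: ep => p' ep' up' _.
apply/hasP; exists (size p').
  by rewrite mem_iota /= add0n; move: (max_card [in x :: p']); rewrite (card_uniqP up').
by apply/walkP; exists p'.
Qed.

Lemma gdist_walk e x y : connect e x y -> walk e (gdist e x y) x y.
Proof.
move=> /has_walk hw; have := nth_find 0 hw.
by rewrite nth_iota ?add0n //; move: hw; rewrite has_find size_iota.
Qed.

Lemma gdist_min e x y n : walk e n x y -> gdist e x y <= n.
Proof.
move=> wn; rewrite leqNgt; apply/negP => lt_n.
have := before_find 0 lt_n; rewrite nth_iota ?add0n ?wn //.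
apply: leq_trans lt_n _; rewrite /gdist.
by rewrite -[X in _ <= X](size_iota 0) find_size.
Qed.

End Graphs.

Definition cube_adj (n : nat) : rel {ffun 'I_n -> bool} :=
  fun u v => #|[set i | u i != v i]| == 1.

Definition graph_iso (T U : finType) (e : rel T) (f : rel U) : Prop :=
  exists2 phi : T -> U, bijective phi & forall x y, f (phi x) (phi y) = e x y.

(* Main.v *)
Require Import Defs.
From mathcomp Require Import all_boot zify.

(* Write [k = b 0] and assume [k < 3 c2]; then no vertex [y] has three vertices at
   distance 2 whose sets of common neighbours with [y] are pairwise disjoint.
   Counting the edges inside the neighbourhood of a vertex shows that there are no
   triangles, and disjointness then gives [a_2 = 0].  Comparing the common
   neighbours of two vertices from both ends of a geodesic of length 4 gives
   [3 c2 <= 2 c3], so [c_i > k / 2] for [i >= 3]: the graph is bipartite and any two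
   vertices at distance 4 from [x] are within distance 2 of each other.
   For [D = 4] double counting forces [c2] to divide [k], so [k = 2 c2] and [b3 = 1].
   For [D = 5] it forces antipodality, with [b3 = c2] and [c3 = k - c2]; the
   Cauchy-Schwarz inequality for the number of common neighbours that [x] shares with
   a fixed pair at distance 2 then leaves only [c2 = 2] and [k = 5].  The cube is
   recovered from a base vertex [o] with neighbours [p_i] by the coordinates
   [d v p_i < d v o]. *)

Set Implicit Arguments.
Unset Strict Implicit.
Unset Printing Implicit Defensive.

(** * Counting in finite sets *)

Section FiniteSets.

Variable T : finType.
Implicit Types A B C X : {set T}.

Lemma leq_cardI A B X :
  A \subset X -> B \subset X -> #|A| + #|B| <= #|X| + #|A :&: B|.
Proof.
move=> sA sB; rewrite -cardsUI leq_add2r.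
by apply: subset_leq_card; rewrite subUset sA.
Qed.

Lemma meetP A B X :
  A \subset X -> B \subset X -> #|X| < #|A| + #|B| ->
  exists2 x, x \in A & x \in B.
Proof.
move=> sA sB lt; have := leq_cardI sA sB.
have [->|[x]] := set_0Vmem (A :&: B); first by rewrite cards0; lia.
by rewrite inE => /andP[xA xB] _; exists x.
Qed.

Lemma leq_card2 A B X :
  A \subset X -> B \subset X -> (forall x, x \in A -> x \in B -> False) ->
  #|A| + #|B| <= #|X|.
Proof.
move=> sA sB dAB; rewrite leqNgt; apply/negP => /(meetP sA sB)[x xA xB].
exact: dAB xB.
Qed.

Lemma leq_card3 A B C X :
  A \subset X -> B \subset X -> C \subset X ->
  (forall x, x \in A -> x \in B -> False) ->
  (forall x, x \in A -> x \in C -> False) ->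
  (forall x, x \in B -> x \in C -> False) -> #|A| + #|B| + #|C| <= #|X|.
Proof.
move=> sA sB sC dAB dAC dBC.
have sU : A :|: B \subset X by rewrite subUset sA.
have dU x : x \in A :|: B -> x \in C -> False.
  by rewrite inE => /orP[]; [apply: dAC | apply: dBC].
apply: leq_trans (leq_card2 sU sC dU); rewrite leq_add2r -cardsUI.
suff -> : A :&: B = set0 by rewrite cards0 addn0.
by apply/setP=> x; rewrite !inE; apply/negbTE/negP => /andP[/dAB].
Qed.

Lemma sum_card_relC (r : rel T) A B :
  \sum_(x in A) #|[set y in B | r x y]| = \sum_(y in B) #|[set x in A | r x y]|.
Proof.
have sumE (A' : {set T}) (q : pred T) : #|[set x in A' | q x]| = \sum_(x in A') q x.
  by rewrite -sum1_card big_mkcond [RHS]big_mkcond; apply: eq_bigr => x _;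
     rewrite inE; case: (x \in A'); case: (q x).
under eq_bigr => x _ do rewrite sumE.
by rewrite exchange_big; apply: eq_bigr => y _; rewrite sumE.
Qed.

(** Cauchy-Schwarz against the constant 1, by summing [2 * (f i * f j) <= f i ^ 2 + f j ^ 2] over
    all pairs. *)
Lemma sqr_sum_leq (I : finType) (P : pred I) (f : I -> nat) :
  (\sum_(i | P i) f i) ^ 2 <= #|P| * \sum_(i | P i) f i ^ 2.
Proof.
suff h : 2 * (\sum_(i | P i) f i) ^ 2 <= 2 * (#|P| * \sum_(i | P i) f i ^ 2).
  by rewrite leq_pmul2l in h.
have -> : 2 * (#|P| * \sum_(i | P i) f i ^ 2)
   = \sum_(i | P i) \sum_(j | P j) (f i ^ 2 + f j ^ 2).
  transitivity (\sum_(i | P i) (#|P| * f i ^ 2 + \sum_(j | P j) f j ^ 2)).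
    by rewrite big_split /= sum_nat_const -big_distrr /=; lia.
  by apply: eq_bigr => i _; rewrite big_split /= sum_nat_const.
rewrite -mulnn big_distrlr /= big_distrr; apply: leq_sum => i _.
by rewrite big_distrr; apply: leq_sum => j _; apply: nat_Cauchy.
Qed.

End FiniteSets.

(** * The path metric of a connected graph *)

Section Metric.

Variables (T : finType) (e : rel T).
Hypotheses (sg : simple_graph e) (cg : connected_graph e).
Implicit Types x y z : T.

Local Notation d := (gdist e).

Definition nb x : {set T} := [set y | e x y].
Definition sph i x : {set T} := [set y | d x y == i].

Lemma edgeC x y : e x y = e y x.
Proof. by case: sg => ->. Qed.

Lemma edgexx x : e x x = false.
Proof. by case: sg => _ ->. Qed.

Lemma gdist_path x y :
  exists p : seq T, [/\ size p = d x y, path e x p & last x p = y].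
Proof. exact/walkP/gdist_walk. Qed.

Lemma gdist_le_path x (p : seq T) : path e x p -> d x (last x p) <= size p.
Proof. by move=> ep; apply/gdist_min/walkP; exists p. Qed.

Lemma gdistxx x : d x x = 0.
Proof. by apply/eqP; rewrite -leqn0 (@gdist_le_path x [::]). Qed.

Lemma gdist0_eq x y : d x y = 0 -> x = y.
Proof. by have [p [<- _ lp]] := gdist_path x y => /size0nil p0; rewrite -lp p0. Qed.

Lemma gdist_triangle x y z : d x z <= d x y + d y z.
Proof.
have [p [<- ep lp]] := gdist_path x y; have [q [<- eq lq]] := gdist_path y z.
rewrite -size_cat -lq -lp -last_cat; apply: gdist_le_path.
by rewrite cat_path ep lp.
Qed.

Lemma gdistC x y : d x y = d y x.
Proof.
suff le u v : d u v <= d v u by apply/eqP; rewrite eqn_leq !le.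
have [p [<- ep <-]] := gdist_path v u.
have := rev_path e v p; rewrite (eq_path (e' := e)) => [rp|a a']; last exact: edgeC.
have := @gdist_le_path (last v p) (rev (belast v p)).
rewrite rp size_rev size_belast => /(_ ep); congr (d _ _ <= _).
by case: (p) => //= a s; rewrite rev_cons last_rcons.
Qed.

Lemma gdist_edge x y : (d x y == 1) = e x y.
Proof.
apply/eqP/idP => [|exy].
  have [[|z [|? ?]] [sp /= ep lp]] := gdist_path x y; rewrite -sp //.
  by move=> _; rewrite -lp; case/andP: ep.
apply/eqP; rewrite eqn_leq (@gdist_le_path x [:: y]) /= ?exy // lt0n.
by apply/eqP => /gdist0_eq xy; rewrite xy edgexx in exy.
Qed.

Lemma edge_gdist x y : e x y -> d x y = 1.
Proof. by rewrite -gdist_edge => /eqP. Qed.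

Lemma in_nb x y : (y \in nb x) = (d x y == 1).
Proof. by rewrite inE gdist_edge. Qed.

Lemma in_sph i x y : (y \in sph i x) = (d x y == i).
Proof. by rewrite inE. Qed.

Lemma gdist_eq0 x y : (d x y == 0) = (y == x).
Proof.
by apply/eqP/eqP => [/gdist0_eq|->] //; apply: gdistxx.
Qed.

Lemma sph0 x : sph 0 x = [set x].
Proof. by apply/setP=> y; rewrite in_sph inE gdist_eq0. Qed.

Lemma sph1 x : sph 1 x = nb x.
Proof. by apply/setP=> y; rewrite in_sph in_nb. Qed.

Lemma sum_card_nbC (A B : {set T}) :
  \sum_(x in A) #|nb x :&: B| = \sum_(y in B) #|nb y :&: A|.
Proof.
transitivity (\sum_(x in A) #|[set y in B | e x y]|).
  by apply: eq_bigr => x _; apply: eq_card => y; rewrite !inE andbC.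
rewrite sum_card_relC; apply: eq_bigr => y _.
by apply: eq_card => x; rewrite !inE andbC edgeC.
Qed.

Lemma edge_count (A B : {set T}) m n :
  (forall x, x \in A -> #|nb x :&: B| = m) ->
  (forall y, y \in B -> #|nb y :&: A| = n) -> #|A| * m = #|B| * n.
Proof.
move=> hA hB; have := sum_card_nbC A B.
by rewrite (eq_bigr _ hA) (eq_bigr _ hB) !sum_nat_const.
Qed.

Lemma geodesic_last x y :
  0 < d x y -> exists2 z, e y z & (d x z).+1 = d x y.
Proof.
have [p [sp ep lp]] := gdist_path x y; rewrite -sp.
case/lastP: p sp ep lp => // p z; rewrite size_rcons rcons_path last_rcons.
move=> sp /andP[ep ez] zy _; subst z; exists (last x p); first by rewrite edgeC.
have := gdist_le_path ep; have := gdist_triangle x (last x p) y.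
by rewrite (edge_gdist ez); lia.
Qed.

Lemma geodesic_mid i j x y :
  d x y = i + j -> exists2 z, d x z = i & d z y = j.
Proof.
elim: j y => [|j IH] y; first by rewrite addn0 => <-; exists y; rewrite ?gdistxx.
rewrite addnS => dxy; have [|z eyz dz] := @geodesic_last x y; first by rewrite dxy.
have [|t dt dtz] := IH z; first lia.
exists t => //; have := gdist_triangle x t y; have := gdist_triangle t z y.
by rewrite edgeC in eyz; rewrite (edge_gdist eyz); lia.
Qed.

End Metric.

(** * Arithmetic of intersection numbers *)

Lemma triangle_arith k c a b1 b2 : a + b1 + 1 = k -> c <= b2 <= b1 ->
  b2 + c <= k < 3 * c -> b1 * (4 * c - k) <= 2 * c * a.-1 ->
  b1 * (4 * c - k) <= 2 * c * (b1 - b2) -> a = 0.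
Proof.
move=> ak /andP[cb b21] /andP[bck kc] h1 h2; case: a => // a in ak h1 *.
(* Here [s < c]. The two hypotheses bound [b1] from above ([h3]) and from below ([h4]); combining
   them eliminates [b1] ([h5]) and leaves 4 c^2 <= 3 c s + s^2, which is impossible. *)
have [s ks] : exists s, k = 2 * c + s by exists (k - 2 * c); lia.
have ksub : 4 * c - k = 2 * c - s by lia.
rewrite ksub /= in h1 h2.
have h3 : b1 * (4 * c - s) <= 2 * c * (2 * c + s - 2).
  have -> : b1 * (4 * c - s) = b1 * (2 * c - s) + 2 * c * b1.
    by rewrite mulnC [2 * c * b1]mulnC -mulnDr mulnC; congr (_ * _); lia.
  have -> : 2 * c + s - 2 = a + b1 by lia.
  by rewrite mulnDr leq_add2r.
have h4 : c * (2 * c) <= b1 * s.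
  have : b1 * (2 * c - s) + b1 * s = b1 * (2 * c) by rewrite -mulnDr; congr (_ * _); lia.
  have : 2 * c * (b1 - b2) + 2 * c * b2 = 2 * c * b1 by rewrite -mulnDr; congr (_ * _); lia.
  have : c * c <= c * b2 by rewrite leq_mul2l cb orbT.
  lia.
have c0 : 0 < 2 * c by lia.
have h5 : c * (4 * c - s) <= s * (2 * c + s - 2).
  rewrite -(leq_pmul2l c0).
  have := leq_mul h4 (leqnn (4 * c - s)); have := leq_mul h3 (leqnn s); lia.
have h6 : c * (4 * c - s) + c * s = c * (4 * c) by rewrite -mulnDr; congr (_ * _); lia.
have h7 : s * (2 * c + s - 2) <= s * (2 * c + s) by rewrite leq_mul2l; lia.
have [t ct] : exists t, c = s + t.+1 by exists (c - s).-1; lia.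
have h8 : c * (4 * c) <= c * s + s * (2 * c + s) by lia.
by rewrite ct in h8; clear -h8; nia.
Qed.

(** The equations for [w] and [k4.-1] give [c * (w + b3) = k * b3 = k + c * k4.-1], so [c] divides
    [k] and the bounds force [k = 2 * c]. The last equation then leaves [b3 = 1] or [b3 = c3], and
    [k < 2 * c3] excludes the latter. *)
Lemma diam4_arith k c c3 b3 w k4 : 2 * c <= k < 3 * c -> k < 2 * c3 -> b3 + c3 = k ->
  0 < b3 -> 0 < k4 -> w * c = (k - c) * b3 -> c * k4.-1 = k * b3.-1 ->
  k4 * c3 * c = k.-1 * (k - c) * b3 -> k = 2 * c /\ b3 = 1.
Proof.
move=> /andP[ck kc] kc3 bc b0 k40 hw h4 hk.
case: b3 b0 bc hw h4 hk => // b3 _ bc hw /= h4 hk; case: k4 k40 h4 hk => // k4 _ /= h4 hk.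
have [m km] : exists m, k = c + m by exists (k - c); lia.
have sub_m : k - c = m by lia.
rewrite sub_m in hw hk.
have kr : k + c * k4 = c * (w + b3.+1) by rewrite h4; clear -hw km; subst k; nia.
have wk4 : w + b3.+1 = k4 + 2.
  have [lt|gt|//] := ltngtP (w + b3.+1) (k4 + 2).
    have : c * (w + b3.+1) <= c * (k4 + 1) by rewrite leq_mul2l; lia.
    lia.
  have : c * (k4 + 3) <= c * (w + b3.+1) by rewrite leq_mul2l; lia.
  lia.
have k2 : k = 2 * c by rewrite wk4 in kr; lia.
have mc : m = c by lia.
have c0 : 0 < c by lia.
have k4E : k4 = 2 * b3.
  by apply/eqP; rewrite -(eqn_pmul2l c0) h4 k2; apply/eqP; lia.
split=> //; rewrite mc k4E in hk.
have {hk} : (2 * b3).+1 * c3 = k.-1 * b3.+1.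
  by apply/eqP; rewrite -(eqn_pmul2r c0) hk; apply/eqP; lia.
have -> : k.-1 = c3 + b3 by lia.
move=> hk; have /eqP : b3 * c3 = b3 * b3.+1 by clear -hk; lia.
by rewrite eqn_mul2l => /orP[]/eqP; lia.
Qed.

(** Multiplying [k4 * b4 = k5 * k] by [c], eliminating [k4] and [k5] and cancelling [c4] gives
    [c + k * b4.-1 = b3 * b4]. For [b4 >= 2] the left side is too large, because [2 * b3 < k]. *)
Lemma diam5_arith k c b3 b4 c4 k4 k5 : 2 * b3 < k -> b4 + c4 = k -> 0 < c4 ->
  0 < b3 -> 0 < b4 -> 0 < k4 -> 0 < k5 -> 0 < c -> c * k5.-1 = k * b4.-1 ->
  c * k4.-1 = c4 * b3.-1 + b4 * k.-1 -> k4 * b4 = k5 * k ->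
  [/\ b4 = 1, b3 = c, k5 = 1 & k4 = k].
Proof.
move=> b3k bc c40 b30 b40 k40 k50 c0.
case: k5 k50 => // k5 _; case: b4 b40 bc => // b4 _ bc; case: k4 k40 => // k4 _ /=.
case: b3 b30 b3k => // b3 _ b3k /= h5 h4 h45.
have key : c + k * b4 = b3.+1 * b4.+1.
  apply/eqP; rewrite -(eqn_pmul2l c40); apply/eqP.
  have e1 : c * (k4.+1 * b4.+1) = c * (k5.+1 * k) by rewrite h45.
  have e2 : b4.+1 * (c * k4) = b4.+1 * (c4 * b3 + b4.+1 * k.-1) by rewrite h4.
  have e3 : k * (c * k5) = k * (k * b4) by rewrite h5.
  have k1 : k.-1 = c4 + b4 by lia.
  have kE : k = c4 + b4.+1 by lia.
  rewrite k1 in e2; rewrite kE in e1 e3 *; clear -e1 e2 e3; lia.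
have b40 : b4 = 0.
  case: b4 {h4 h45 h5} bc key => // b4 bc key; suff: False by []; clear -b3k key c0; nia.
subst b4; rewrite muln0 addn0 muln1 in key; rewrite muln0 in h5.
have k50 : k5 = 0 by move/eqP: h5; rewrite muln_eq0; lia.
by split; lia.
Qed.

(** Used with [c 2], [c 3] and the number [n] of vertices at distance 2 from both members of a pair
    at distance 2. Eliminating [n] and cancelling [m] leaves c^3 + c m + m <= 2 c^2 + m^2, which
    fails for [c >= 3] since [m < 2 * c]. *)
Lemma taut_arith c m n : 1 < c -> 0 < m < 2 * c ->
  n * c = c * (c + m - 2) + m * m.-1 ->
  (c * (c + m - 2)) ^ 2 <= n * (c * (c + m - 2) + c * (c.-1 * (c - 2))) -> c = 2.
Proof.
case: c => // -[|c] // _; case: m => // m /=.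
have -> : c.+2 + m.+1 - 2 = c + m.+1 by lia.
have -> : c.+2 - 2 = c by lia.
move=> mc hn; have -> : c.+2 * (c + m.+1) + c.+2 * (c.+1 * c)
  = c.+2 * (c + m.+1 + c.+1 * c) by lia.
rewrite mulnA hn -mulnn => h.
have {h}: m.+1 * (c.+2 * c.+2 * c.+2 + c.+2 * m.+1 + m.+1)
    <= m.+1 * (2 * (c.+2 * c.+2) + m.+1 * m.+1) by clear -h; lia.
rewrite leq_pmul2l // => h; case: c mc hn h => // c mc _ h.
suff: False by []; clear -mc h.
have [t mt] : exists t, 2 * c + 5 = m + t by exists (2 * c + 5 - m); lia.
nia.
Qed.

Lemma card_cube_nb n (f : {ffun 'I_n -> bool}) : #|[set g | cube_adj f g]| <= n.
Proof.
pose flip (i : 'I_n) : {ffun 'I_n -> bool} := [ffun j => (j == i) (+) f j].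
have : #|[set flip i | i : 'I_n]| <= n.
  by apply: leq_trans (leq_imset_card flip _) _; rewrite card_ord.
apply: leq_trans; apply/subset_leq_card/subsetP=> g.
rewrite inE => /cards1P[i fg]; apply/imsetP; exists i => //.
apply/ffunP=> j; rewrite ffunE -in_set1 -fg inE.
by case: (f j); case: (g j).
Qed.

(** * Distance-regular graphs *)

Section DistanceRegular.

Variables (T : finType) (e : rel T) (D : nat) (b c : nat -> nat).
Hypothesis hG : distance_regular e D b c.
Implicit Types x y z u v w p q : T.

Local Notation d := (gdist e).
Local Notation nb := (nb e).
Local Notation sph := (sph e).
Local Notation k := (b 0).

Lemma drg_simple : simple_graph e. Proof. by case: hG. Qed.
Lemma drg_connected : connected_graph e. Proof. by case: hG. Qed.

Local Notation sg := drg_simple.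
Local Notation cg := drg_connected.

Ltac met x y z :=
  move: (gdist_triangle cg x y z) (gdist_triangle cg y z x)
        (gdist_triangle cg z x y) (gdistC sg cg x y) (gdistC sg cg y z)
        (gdistC sg cg x z).

Definition in_dist := (in_setI, in_nb sg cg, in_sph).

Lemma gdist_leD x y : d x y <= D.
Proof.
case: hG => _ _ <- _ _; apply: leq_trans (leq_bigmax x).
exact: (leq_bigmax (F := fun y => d x y) y).
Qed.

Lemma ex_gdist i : 0 < D -> i <= D -> exists x y, d x y = i.
Proof.
move=> D0 iD; have [x [y dxy]] : exists x y, d x y = D.
  case: hG => _ _ dD _ _; have T0 : 0 < #|T|.
    rewrite lt0n; apply/eqP => T0; move: D0; rewrite -dD /diameter big1 // => x.
    by have := fintype0 x T0.
  have [x mx] := eq_bigmax (fun x => \max_y d x y) T0.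
  have [y my] := eq_bigmax (d x) T0.
  by exists x, y; rewrite -my -mx -dD.
have [|z dz _] := @geodesic_mid _ _ sg cg i (D - i) x y; first lia.
by exists x, z.
Qed.

Lemma card_c i x y : d x y = i.+1 -> #|nb y :&: sph i x| = c i.+1.
Proof.
move=> dxy; case: hG => _ _ _ _ /(_ x y)[+ _]; rewrite dxy => <-.
by apply: eq_card => z; rewrite !inE eqSS.
Qed.

Lemma card_b i x y : d x y = i -> #|nb y :&: sph i.+1 x| = b i.
Proof.
move=> <-; case: hG => _ _ _ _ /(_ x y)[_ <-].
by apply: eq_card => z; rewrite !inE.
Qed.

Lemma card_nb x : #|nb x| = k.
Proof. by rewrite -(@card_b 0 x x) ?gdistxx // (sph1 sg cg) setIid. Qed.

(** The first summand is the intersection number a_i. *)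
Lemma card_nbI i x y : d x y = i -> #|nb y :&: sph i x| + b i + c i = k.
Proof.
move=> dxy; rewrite -(card_nb y) -(cardsID (sph i x) (nb y)) -addnA; congr (_ + _).
rewrite -(cardsID (sph i.+1 x)); congr (_ + _).
  rewrite -(card_b dxy); apply: eq_card => z; rewrite !inE.
  by case: (d x z =P i) => [->|_] //=; rewrite ?ltn_eqF // !andbF.
case: hG => _ _ _ _ /(_ x y)[+ _]; rewrite dxy => <-.
apply: eq_card => z; rewrite in_setD in_setD !in_sph in_set in_set.
have [eyz|] := boolP (e y z); last by rewrite ?andbF.
have := edge_gdist sg cg eyz; met x y z; lia.
Qed.

Lemma card_cC i x y : d x y = i.+1 -> #|nb x :&: sph i y| = c i.+1.
Proof. by rewrite (gdistC sg cg); apply: card_c. Qed.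

Lemma card_common x y : d x y = 2 -> #|nb x :&: nb y| = c 2.
Proof. by move=> dxy; rewrite -(sph1 sg cg y); apply: card_cC. Qed.

Lemma b_gt0 i : i < D -> 0 < b i.
Proof.
move=> iD; have [x [y dxy]] := @ex_gdist i.+1 (leq_ltn_trans (leq0n i) iD) iD.
have [|z eyz dz] := @geodesic_last _ _ sg cg x y; first lia.
rewrite -(@card_b i x z); last lia.
by apply/card_gt0P; exists y; rewrite !in_dist dxy eqxx (gdist_edge sg cg) (edgeC sg) eyz.
Qed.

Lemma c_gt0 i : 0 < i <= D -> 0 < c i.
Proof.
case: i => // i /= iD; have [x [y dxy]] := @ex_gdist i.+1 (leq_ltn_trans (leq0n i) iD) iD.
have [|z eyz dz] := @geodesic_last _ _ sg cg x y; first lia.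
rewrite -(card_c dxy); apply/card_gt0P; exists z.
by move: (edge_gdist sg cg eyz); rewrite !in_dist; lia.
Qed.

Lemma c1 : 0 < D -> c 1 = 1.
Proof.
move=> D0; have [x [y dxy]] := @ex_gdist 1 D0 D0.
rewrite -(card_c dxy) -(cards1 x); apply: eq_card => z.
rewrite !in_dist (gdist_eq0 cg) in_set1; case: (z =P x) => [->|]; last by rewrite andbF.
by rewrite (gdistC sg cg) dxy.
Qed.

Lemma geodesic_extend i j x y :
  d x y = i -> i + j <= D -> exists2 z, d x z = i + j & d y z = j.
Proof.
move=> dxy; elim: j => [|j IH] ijD; first by exists y; rewrite ?gdistxx ?addn0.
have [|z dxz dyz] := IH; first lia.
have : 0 < #|nb z :&: sph (i + j).+1 x| by rewrite (card_b dxz) b_gt0; lia.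
case/card_gt0P=> t; rewrite !in_dist => /andP[/eqP dzt /eqP dxt].
exists t; first lia.
by met x y t; met y z t; lia.
Qed.

(** On a geodesic from [x] through [y] to [z], a neighbour of [y] closer to [z] is farther from
    [x]. *)
Lemma leq_c_b i j : 0 < j -> i + j <= D -> c j <= b i.
Proof.
case: j => // j _ ijD; have [|x [y dxy]] := @ex_gdist i _ (leq_trans (leq_addr _ _) ijD); first lia.
have [z dxz dyz] := geodesic_extend dxy ijD.
rewrite -(card_cC dyz) -(card_b dxy); apply: subset_leq_card.
apply/subsetP=> t; rewrite !in_dist; met x y t; met x t z; met y t z; lia.
Qed.

Lemma leq_c i : 0 < i < D -> c i <= c i.+1.
Proof.
case: i => // i /= iD; have [x [y dxy]] : exists x y, d x y = i.+2 by apply: ex_gdist; lia.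
have [p dxp dpy] := @geodesic_mid _ _ sg cg 1 i.+1 x y dxy.
rewrite -(card_c dpy) -(card_c dxy); apply: subset_leq_card.
apply/subsetP=> t; rewrite !in_dist; met x p t; met x y t; lia.
Qed.

Lemma leq_b i : i.+1 < D -> b i.+1 <= b i.
Proof.
move=> iD; have [x [y dxy]] : exists x y, d x y = i.+1 by apply: ex_gdist; lia.
have [p dxp dpy] := @geodesic_mid _ _ sg cg 1 i x y dxy.
rewrite -(card_b dpy) -(card_b dxy); apply: subset_leq_card.
apply/subsetP=> t; rewrite !in_dist; met x p t; met p y t; lia.
Qed.

Lemma card_sphS i x : #|sph i x| * b i = #|sph i.+1 x| * c i.+1.
Proof.
apply: (edge_count sg) => y; rewrite in_sph => /eqP dxy; first exact: card_b.
exact: card_c.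
Qed.

(** Edges are counted between this set and the [b 2] neighbours of [y] at distance 3 from [u]: all
    common neighbours of [y] and a vertex of the set are of that kind. *)
Lemma card_far u y : 4 <= D -> d u y = 2 ->
  #|sph 4 u :&: sph 2 y| * c 2 = b 2 * b 3.
Proof.
move=> D4 duy; rewrite -(card_b duy); apply/esym/(edge_count sg) => z.
  rewrite !in_dist => /andP[/eqP dyz /eqP duz]; rewrite -(card_b duz).
  apply: eq_card => w; rewrite !in_dist; met u y w; met y z w; lia.
rewrite !in_dist => /andP[/eqP duz /eqP dyz]; rewrite -(card_common dyz) setIC.
apply: eq_card => w; rewrite !in_dist; met u y w; met u z w; met y z w; lia.
Qed.

(** * Edges inside a neighbourhood *)

Definition nbpairs y u :=
  \sum_(p in nb y) \sum_(s in nb y :&: nb p) (e u p && e u s : nat).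

(** Thus [nbpairs y u] is twice the number of edges among the common neighbours of [y] and [u]. Its
    definition by ordered pairs serves the exchange of sums in [sum_nbpairs]. *)
Lemma nbpairsE y u :
  nbpairs y u = \sum_(p in nb y :&: nb u) #|nb p :&: (nb y :&: nb u)|.
Proof.
rewrite /nbpairs big_mkcond [RHS]big_mkcond; apply: eq_bigr => p _.
rewrite !in_setI; case: ifP => // _; rewrite [p \in nb u]inE /=.
case: (e u p); last by rewrite big1.
rewrite -sum1_card big_mkcond [RHS]big_mkcond; apply: eq_bigr => s _.
by rewrite !inE; case: (e y s); case: (e p s); case: (e u s).
Qed.

(* No edge joins the common neighbours of [y], [u] to those of [y], [w], so every
   edge leaving either set inside [nb y] ends in the remaining [k - 2 c2] vertices. *)
Lemma nbpairs_far y u w (a := k - b 1 - c 1) :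
  d y u = 2 -> d y w = 2 -> d u w = 4 ->
  2 * c 2 * a <= nbpairs y u + nbpairs y w + a * (k - 2 * c 2).
Proof.
move=> dyu dyw duw; rewrite !nbpairsE.
set C := nb y :&: nb u; set C' := nb y :&: nb w; set R := nb y :\: (C :|: C').
have cC : #|C| = c 2 by apply: card_common.
have cC' : #|C'| = c 2 by apply: card_common.
have aE p : p \in nb y -> #|nb p :&: nb y| = a.
  rewrite (in_nb sg cg) => /eqP dyp.
  by have := card_nbI dyp; rewrite (sph1 sg cg) /a; lia.
have nCC' p s : p \in C -> s \in C' -> s \notin nb p.
  rewrite !in_dist => /andP[_ /eqP dup] /andP[_ /eqP dws]; apply/eqP => dps.
  by met u p s; met u s w; lia.
have cR : #|R| = k - 2 * c 2.
  rewrite cardsD (setIidPr _) ?subUset ?subsetIl // card_nb cardsU cC cC'.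
  suff -> : C :&: C' = set0 by rewrite cards0; lia.
  apply/setP=> p; rewrite inE [RHS]inE; apply/negP => /andP[].
  by rewrite !in_dist; met u p w; lia.
(* The [a] neighbours of [p] inside [nb y] miss [A'], hence lie in [A] or [R]. *)
have split (A A' : {set T}) p : A \subset nb y -> A' \subset nb y ->
    p \in A -> (forall s, s \in A' -> s \notin nb p) -> nb y :\: (A :|: A') = R ->
    a <= #|nb p :&: A| + #|nb p :&: R|.
  move=> sA sA' pA nA' defR; rewrite -(aE p (subsetP sA _ pA)) -cardsUI.
  apply: leq_trans (leq_addr _ _); apply: subset_leq_card; apply/subsetP=> s.
  rewrite !in_setI in_setU !in_setI -defR in_setD in_setU => /andP[ps ys].
  have [sA'0|_] := boolP (s \in A'); first by have := nA' _ sA'0; rewrite ps.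
  by rewrite ps ys orbF andbT /=; case: (s \in A).
have sumC : c 2 * a <= \sum_(p in C) #|nb p :&: C| + \sum_(p in C) #|nb p :&: R|.
  rewrite -{1}cC -sum_nat_const -big_split /=; apply: leq_sum => p pC.
  by apply: (split C C') => //; rewrite ?subsetIl // => s; apply: nCC'.
have sumC' : c 2 * a <= \sum_(p in C') #|nb p :&: C'| + \sum_(p in C') #|nb p :&: R|.
  rewrite -{1}cC' -sum_nat_const -big_split /=; apply: leq_sum => p pC'.
  apply: (split C' C) => //; rewrite ?subsetIl //; last by rewrite setUC.
  move=> s sC; have := nCC' _ _ sC pC'; by rewrite !(in_nb sg cg) (gdistC sg cg).
have sumR : \sum_(p in C) #|nb p :&: R| + \sum_(p in C') #|nb p :&: R| <= #|R| * a.
  rewrite (sum_card_nbC sg C R) (sum_card_nbC sg C' R) -big_split.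
  rewrite -sum_nat_const /=; apply: leq_sum => s.
  rewrite in_setD => /andP[_ ys]; rewrite -(aE s ys); apply: leq_card2.
  - by apply: setIS; apply: subsetIl.
  - by apply: setIS; apply: subsetIl.
  by move=> p; rewrite !in_dist; met u p w; lia.
rewrite cR in sumR; lia.
Qed.

(** There are [k * a] ordered adjacent pairs in [nb y], and each is counted once for every [u]
    adjacent to both members. *)
Lemma sum_nbpairs y m (a := k - b 1 - c 1) :
  (forall p s, p \in nb y -> s \in nb y -> e p s ->
     #|nb p :&: nb s :&: sph 2 y| <= m) ->
  \sum_(u in sph 2 y) nbpairs y u <= k * a * m.
Proof.
move=> hm; rewrite /nbpairs exchange_big /= -mulnA -(card_nb y) -sum_nat_const.
apply: leq_sum => p yp; rewrite exchange_big /=.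
have -> : a = #|nb y :&: nb p|.
  move: yp; rewrite (in_nb sg cg) => /eqP dyp; have := card_nbI dyp.
  by rewrite (sph1 sg cg) setIC /a; lia.
rewrite -sum_nat_const; apply: leq_sum => s; rewrite in_setI => /andP[ys ps].
apply: leq_trans (hm p s yp ys _); last by rewrite inE in ps.
rewrite -sum1_card [leqRHS]big_mkcond [leqLHS]big_mkcond; apply: leq_sum => u _.
by rewrite !inE (edgeC sg u) (edgeC sg u); case: (e p u); case: (e s u); case: (d y u == 2).
Qed.

(* If [u] is one of the vertices counted, then the neighbours of [p] and of [s] in
   [nb y] avoid the [b 2] vertices of [nb y] at distance 3 from [u]; hence they
   overlap, which leaves few common neighbours of [p] and [s] outside [nb y]. *)
Lemma card_triangle_le y p s (a := k - b 1 - c 1) : 3 <= D ->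
  e y p -> e y s -> e p s ->
  #|nb p :&: nb s :&: sph 2 y| <= a.-1 /\
  #|nb p :&: nb s :&: sph 2 y| <= b 1 - b 2.
Proof.
move=> D3 /(edge_gdist sg cg) yp /(edge_gdist sg cg) ys /(edge_gdist sg cg) ps.
have b21 : b 2 <= b 1 by apply: leq_b; lia.
have aE x z : d x z = 1 -> #|nb x :&: nb z| + b 1 + 1 = k.
  by move=> xz; rewrite -(card_nbI xz) (sph1 sg cg) setIC (c1 (ltnW (ltnW D3))).
have aps := aE _ _ ps; have ayp := aE _ _ yp; have ays := aE _ _ ys.
set X := nb p :&: nb s :&: sph 2 y; set L := nb p :&: nb s :&: nb y.
(* The common neighbours of [p] and [s] include [y] itself, besides [L] and [X]; this alone gives
   the first bound. *)
have cXL : 1 + #|L| + #|X| <= #|nb p :&: nb s|.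
  rewrite -(cards1 y); apply: leq_card3; rewrite ?subsetIl //.
  - by rewrite sub1set !in_dist; met y p s; lia.
  - by move=> x; rewrite inE => /eqP->; rewrite !in_dist gdistxx !andbF.
  - by move=> x; rewrite inE => /eqP->; rewrite !in_dist gdistxx !andbF.
  by move=> x; rewrite !in_dist; lia.
have c11 : c 1 = 1 by apply: c1; lia.
split; first by rewrite /a; lia.
have [->|[u]] := set_0Vmem X; first by rewrite cards0.
rewrite !in_dist => /andP[/andP[/eqP pu /eqP su] /eqP yu].
have uy : d u y = 2 by rewrite (gdistC sg cg).
have cB : #|nb y :\: sph 3 u| = k - b 2 by rewrite cardsD card_nb (card_b uy).
have sub q : d y q = 1 -> d q u = 1 -> q |: (nb y :&: nb q) \subset nb y :\: sph 3 u.
  move=> yq qu; apply/subsetP=> t; rewrite in_setU1 in_setD !in_dist.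
  case: (t =P q) => [->|_] /=; first by rewrite yq (gdistC sg cg u q) qu.
  by met u q t; lia.
have := leq_cardI (sub p yp pu) (sub s ys su); rewrite cB.
have cq q : #|q |: (nb y :&: nb q)| = (#|nb y :&: nb q|).+1.
  by rewrite cardsU1 !in_dist gdistxx andbF.
(* Hence [2 * (a + 1) <= k - b 2 + #|L| + 2]; this lower bound on [#|L|], put into [cXL], gives
   [b 1 - b 2]. *)
have : #|(p |: (nb y :&: nb p)) :&: (s |: (nb y :&: nb s))| <= #|L| + 2.
  have <- : #|[set p; s]| = 2.
    by rewrite cards2; case: (p =P s) ps => // ->; rewrite gdistxx.
  apply: leq_trans (leq_card_setU _ _); apply: subset_leq_card; apply/subsetP=> t.
  rewrite !(in_setU, in_setI, in_set1).
  by case: (t == p); case: (t == s); case: (t \in nb y); case: (t \in nb p); case: (t \in nb s).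
rewrite !cq; lia.
Qed.

(** Summing [nbpairs_far] over the pairs at distance 4 in [sph 2 y] bounds the total [S] of
    [nbpairs] from below. Both bounds of [card_triangle_le] limit [S] from above, and
    [triangle_arith] shows the two sides are compatible only when a_1 = 0. *)
Lemma triangle_free : 4 <= D -> k < 3 * c 2 -> b 1 = k.-1.
Proof.
move=> D4 c2k; pose a := k - b 1 - c 1.
have [y _] : exists y : T, True by have [|//|y [_ _]] := @ex_gdist 0; [lia|exists y].
(* The division is exact by [card_far]: each [u] in [X] has [W] vertices of [X] at distance 4. *)
pose X := sph 2 y; pose W := b 2 * b 3 %/ c 2.
have c2gt0 : 0 < c 2 by apply: c_gt0; lia.
have b1gt0 : 0 < b 1 by apply: b_gt0; lia.
have b2gt0 : 0 < b 2 by apply: b_gt0; lia.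
have cb22 : c 2 <= b 2 by apply: leq_c_b.
have b21 : b 2 <= b 1 by apply: leq_b; lia.
have c11 : c 1 = 1 by apply: c1; lia.
have [x2 [y2 d2]] : exists x y, d x y = 2 by apply: ex_gdist; lia.
have k2 := card_nbI d2.
have [x1 [y1 d1]] : exists x y, d x y = 1 by apply: ex_gdist; lia.
have k1 := card_nbI d1.
have cW u : u \in X -> #|X :&: sph 4 u| = W.
  rewrite in_sph (gdistC sg cg) => /eqP uy; rewrite /W -(card_far D4 uy) mulnK //.
  by rewrite setIC.
have W0 : 0 < W.
  rewrite divn_gt0 //; apply: leq_trans cb22 _; rewrite leq_pmulr //.
  by apply: b_gt0; lia.
have XE : #|X| * c 2 = k * b 1 by rewrite -card_sphS (sph1 sg cg) card_nb.
pose S := \sum_(u in X) nbpairs y u.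
have SE : \sum_(u in X) \sum_(w in X :&: sph 4 u) nbpairs y u = S * W.
  rewrite /S big_distrl /=; apply: eq_bigr => u uX.
  by rewrite sum_nat_const cW // mulnC.
have SE' : \sum_(u in X) \sum_(w in X :&: sph 4 u) nbpairs y w = S * W.
  rewrite -SE (exchange_big_dep (mem X)) /=; last by move=> u w _; rewrite inE => /andP[].
  apply: eq_bigr => w wX; apply: eq_bigl => u; rewrite !in_dist (gdistC sg cg u w).
  by move: wX; rewrite inE => ->.
have hS : #|X| * (2 * c 2 * a) <= 2 * S + #|X| * (a * (k - 2 * c 2)).
  rewrite -(leq_pmul2r W0).
  have sumW m : \sum_(u in X) \sum_(w in X :&: sph 4 u) m = #|X| * m * W.
    rewrite -mulnA -sum_nat_const; apply: eq_bigr => u uX.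
    by rewrite sum_nat_const cW // mulnC.
  have -> : (2 * S + #|X| * (a * (k - 2 * c 2))) * W
      = S * W + S * W + #|X| * (a * (k - 2 * c 2)) * W by lia.
  rewrite -{1}SE -SE' -!sumW -!big_split /=; apply: leq_sum => u uX.
  rewrite -!big_split /=; apply: leq_sum => w; rewrite in_setI => /andP[wX uw].
  by apply: nbpairs_far; apply/eqP; rewrite -in_sph.
have S1 : S <= k * a * a.-1.
  apply: sum_nbpairs => p s; rewrite !inE => yp ys ps.
  by have [] := card_triangle_le (ltnW D4) yp ys ps.
have S2 : S <= k * a * (b 1 - b 2).
  apply: sum_nbpairs => p s; rewrite !inE => yp ys ps.
  by have [] := card_triangle_le (ltnW D4) yp ys ps.
have [a0|a0] := posnP a; first by rewrite /a in a0; lia.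
have key m : S <= k * a * m -> b 1 * (4 * c 2 - k) <= 2 * c 2 * m.
  move=> Sm; have ka0 : 0 < k * a by rewrite muln_gt0 a0 andbT; lia.
  have hX : #|X| * (a * (4 * c 2 - k)) <= 2 * S by nia.
  rewrite -(leq_pmul2l ka0); set t := 4 * c 2 - k in hX *.
  have -> : k * a * (b 1 * t) = c 2 * (#|X| * (a * t)).
    by have : k * b 1 * a * t = #|X| * c 2 * a * t by [rewrite XE]; lia.
  have -> : k * a * (2 * c 2 * m) = c 2 * (2 * (k * a * m)) by lia.
  by rewrite leq_mul2l; apply/orP; right; apply: leq_trans hX _; rewrite leq_mul2l.
have aE : a + b 1 + 1 = k by rewrite /a; lia.
have a_eq0 : a = 0.
  by apply: (triangle_arith aE _ _ (key _ S1) (key _ S2)); lia.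
by rewrite a_eq0 in a0.
Qed.

(** The condition a_i = 0; for all [i <= D] together it is bipartiteness. *)
Definition flat_free i := forall x y z, d x y = i -> d x z = i -> e y z -> False.

Lemma flat_free_bc i : i <= D -> 0 < D -> flat_free i -> b i + c i = k.
Proof.
move=> iD D0 fi; have [x [y dxy]] := ex_gdist D0 iD; rewrite -(card_nbI dxy).
suff -> : nb y :&: sph i x = set0 by rewrite cards0.
apply/setP=> z; rewrite inE in_sph !inE; apply/negP => /andP[eyz /eqP dxz].
exact: fi dxy dxz eyz.
Qed.

Lemma bc_flat_free i : b i + c i = k -> flat_free i.
Proof.
move=> bc x y z dxy dxz eyz; have := card_nbI dxy.
have : 0 < #|nb y :&: sph i x|.
  by apply/card_gt0P; exists z; rewrite inE in_sph dxz eqxx inE eyz.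
lia.
Qed.

(** * Large c2 *)

Section LargeC2.

Hypotheses (D4 : 4 <= D) (D5 : D <= 5) (k3 : 3 <= k) (c2k : k < 3 * c 2).

Lemma flat_free1 : flat_free 1.
Proof.
apply: bc_flat_free; rewrite triangle_free // c1; lia.
Qed.

Lemma flat_free2 : flat_free 2.
Proof.
move=> x y z dxy dxz eyz; have dyz := edge_gdist sg cg eyz.
have dyx : d y x = 2 by rewrite (gdistC sg cg).
(* Now [y], [z], [w] are at distance 2 from [x]. A common neighbour of [y] and [z] would close a
   triangle, while [w] is at distance 4 from [y] and so at least 3 from [z]. *)
have [w dyw dxw] := @geodesic_extend 2 2 y x dyx D4.
suff : #|nb x :&: nb y| + #|nb x :&: nb z| + #|nb x :&: nb w| <= #|nb x|.
  by rewrite !card_common // card_nb; lia.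
apply: leq_card3; rewrite ?subsetIl // => t; rewrite !in_dist.
- move=> /andP[_ /eqP yt] /andP[_ /eqP zt].
  by apply: (@flat_free1 t y z) => //; rewrite (gdistC sg cg).
- by met y t w; lia.
by met y z t; met y t w; lia.
Qed.

Lemma bc2 : b 2 + c 2 = k.
Proof. by apply: flat_free_bc; [lia|lia|exact: flat_free2]. Qed.

Lemma two_c2_le : 2 * c 2 <= k.
Proof. by have : c 2 <= b 2 by [apply: leq_c_b]; have := bc2; lia. Qed.

Lemma gdist_nb2 z u v : e z u -> e z v -> u != v -> d u v = 2.
Proof.
move=> ezu ezv uv; have zu := edge_gdist sg cg ezu; have zv := edge_gdist sg cg ezv.
have n1 : d u v <> 1.
  by move/eqP; rewrite (gdist_edge sg cg); apply: flat_free1 zu zv.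
have : d u v != 0 by rewrite (gdist_eq0 cg) eq_sym.
by met z u v; lia.
Qed.

(** Both sets of [c 2] common neighbours lie among the [c 3] neighbours of [x] at distance 2 from
    [z]. *)
Lemma share_c2 x z u v : d x z = 3 -> e z u -> e z v -> d x u = 2 -> d x v = 2 ->
  2 * c 2 <= c 3 + #|nb x :&: nb u :&: (nb x :&: nb v)|.
Proof.
move=> xz /(edge_gdist sg cg) zu /(edge_gdist sg cg) zv xu xv.
have sub t : d z t = 1 -> d x t = 2 -> nb x :&: nb t \subset nb x :&: sph 2 z.
  by move=> zt xt; apply/subsetP=> s; rewrite !in_dist; met x z s; met z t s; lia.
have := leq_cardI (sub u zu xu) (sub v zv xv).
by rewrite !card_common // (card_cC xz); lia.
Qed.

(* Two neighbours [u], [v] of [z] at distance 2 from [x] have at least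
   [2 c2 - c3] common neighbours next to [x] and, by symmetry, as many next to
   a vertex [w] with [d x w = 4]; all of these are among their [c2] common
   neighbours. *)
Lemma leq_c2_c3 : 3 * c 2 <= 2 * c 3.
Proof.
have [x [z xz]] : exists x z, d x z = 3 by apply: ex_gdist; lia.
have c23 : c 2 <= c 3 by apply: leq_c; lia.
have : 1 < #|nb z :&: sph 2 x| by rewrite (card_c xz); lia.
case/card_gt1P=> u [v []]; rewrite !in_setI !in_sph !(in_set, inE).
move=> /andP[zu /eqP xu] /andP[zv /eqP xv] uv.
have [w xw zw] := @geodesic_extend 3 1 x z xz D4.
have uv2 := gdist_nb2 zu zv uv.
have dzu := edge_gdist sg cg zu; have dzv := edge_gdist sg cg zv.
have h1 := share_c2 xz zu zv xu xv.
have [|c3s] := leqP (2 * c 2) (c 3); first lia.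
have : 0 < #|nb x :&: nb u :&: (nb x :&: nb v)| by lia.
case/card_gt0P=> q; rewrite !in_dist => /andP[/andP[/eqP xq /eqP uq] /andP[_ /eqP vq]].
(* Seen from [w], the vertex [q] plays the part of [z]: it is adjacent to [u] and [v] and at
   distance 3 from [w]. *)
have h2 : 2 * c 2 <= c 3 + #|nb w :&: nb u :&: (nb w :&: nb v)|.
  apply: (@share_c2 w q u v).
  - by met x q w; met q u w; met u z w; met x u w; lia.
  - by rewrite -(gdist_edge sg cg) (gdistC sg cg) uq.
  - by rewrite -(gdist_edge sg cg) (gdistC sg cg) vq.
  - by met x u w; met u z w; lia.
  by met x v w; met v z w; lia.
suff : #|nb x :&: nb u :&: (nb x :&: nb v)| + #|nb w :&: nb u :&: (nb w :&: nb v)|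
    <= #|nb u :&: nb v| by rewrite (card_common uv2); lia.
apply: leq_card2.
- by apply: setISS; apply: subsetIr.
- by apply: setISS; apply: subsetIr.
by move=> t; rewrite !in_dist; met x t w; lia.
Qed.

Lemma half_lt_c i : 3 <= i <= D -> k < 2 * c i.
Proof.
elim: i => // i IH /andP[i3 iD]; have [i2|i2] := leqP i 2.
  have -> : i = 2 by lia.
  by have := leq_c2_c3; lia.
have : c i <= c i.+1 by apply: leq_c; lia.
by have := IH _; lia.
Qed.

(* As [c_{i+1} > k / 2], adjacent [y], [z] at distance [i + 1] from [x] would be at
   distance [i] from a common neighbour [p] of [x]. *)
Lemma flat_freeT i : i <= D -> flat_free i.
Proof.
elim: i => [_ x y z xy xz|i IH iD].
  by rewrite -(gdist0_eq cg xy) -(gdist0_eq cg xz) (edgexx sg).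
have [i2|i2] := leqP i 1.
  by have [->|->] : i = 0 \/ i = 1 by [lia]; [exact: flat_free1|exact: flat_free2].
move=> x y z xy xz eyz.
have lt_p : #|nb x| < #|nb x :&: sph i y| + #|nb x :&: sph i z|.
  by rewrite card_nb !card_cC //; have := @half_lt_c i.+1; lia.
have [p] := meetP (subsetIl _ _) (subsetIl _ _) lt_p.
rewrite !in_dist => /andP[_ /eqP yp] /andP[_ /eqP zp].
by apply: (IH _ p y z) => //; [lia | rewrite (gdistC sg cg) | rewrite (gdistC sg cg)].
Qed.

Lemma bipartite_edge x y z : e y z -> d x y <> d x z.
Proof. by move=> eyz xy; apply: (flat_freeT (gdist_leD x z) xy erefl eyz). Qed.

Lemma bcE i : i <= D -> b i + c i = k.
Proof. by move=> iD; apply: flat_free_bc => //; [lia|exact: flat_freeT]. Qed.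

(** * Vertices at distance 4 from a common vertex *)

Lemma gdist_far x w v : d x w = 4 -> d x v = 4 -> d w v <= 2.
Proof.
move=> xw xv; rewrite leqNgt; apply/negP => wv.
have c4 := @half_lt_c 4; have c3 := @half_lt_c 3.
(* Since [c 4] and [c 3] exceed k / 2, two steps from [x] can approach [w] and [v] at once. They end
   at [y], at distance 2 from [x], [w] and [v], no two of which share a neighbour. *)
have lt_p : #|nb x| < #|nb x :&: sph 3 w| + #|nb x :&: sph 3 v|.
  by rewrite card_nb !card_cC //; lia.
have [p] := meetP (subsetIl _ _) (subsetIl _ _) lt_p.
rewrite !in_dist => /andP[/eqP xp /eqP wp] /andP[_ /eqP vp].
have pw : d p w = 3 by rewrite (gdistC sg cg).
have pv : d p v = 3 by rewrite (gdistC sg cg).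
have lt_y : #|nb p| < #|nb p :&: sph 2 w| + #|nb p :&: sph 2 v|.
  by rewrite card_nb !card_cC //; lia.
have [y] := meetP (subsetIl _ _) (subsetIl _ _) lt_y.
rewrite !in_dist => /andP[/eqP py /eqP wy] /andP[_ /eqP vy].
have yx : d y x = 2 by met x p y; met x y w; lia.
have yw : d y w = 2 by rewrite (gdistC sg cg).
have yv : d y v = 2 by rewrite (gdistC sg cg).
suff : #|nb y :&: nb x| + #|nb y :&: nb w| + #|nb y :&: nb v| <= #|nb y|.
  by rewrite !card_common // card_nb; lia.
apply: leq_card3; rewrite ?subsetIl // => t; rewrite !in_dist.
- by met x t w; lia.
- by met x t v; lia.
by met w t v; lia.
Qed.

Lemma card_nbD1 (A : {set T}) t z : t \in A -> e z t -> #|nb z :&: (A :\ t)| = #|nb z :&: A|.-1.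
Proof.
move=> tA zt; rewrite setIDA [in RHS](cardsD1 t).
by rewrite in_setI tA inE zt.
Qed.

Lemma gdist_far2 x w v : d x w = 4 -> d x v = 4 -> w != v -> d w v = 2.
Proof.
move=> xw xv wv; have le2 := gdist_far xw xv.
have : d w v != 0 by rewrite (gdist_eq0 cg) eq_sym.
have : d w v <> 1.
  by move/eqP; rewrite (gdist_edge sg cg) => /(@bipartite_edge x); rewrite xw xv.
by lia.
Qed.

(** Counts pairs of another vertex [v] of [sph 4 x] and a common neighbour [z] of [v] and [t]. Of
    the neighbours [z] of [t], [c 4] are at distance 3 from [x] and [b 4] at distance 5; all
    neighbours of the latter are back in [sph 4 x]. *)
Lemma card_sph4 x t : d x t = 4 ->
  c 2 * #|sph 4 x|.-1 = c 4 * (b 3).-1 + b 4 * k.-1.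
Proof.
move=> xt; have tx : t \in sph 4 x by rewrite in_sph xt.
have -> : #|sph 4 x|.-1 = #|sph 4 x :\ t| by rewrite [in LHS](cardsD1 t) tx.
have -> : c 2 * #|sph 4 x :\ t| = \sum_(v in sph 4 x :\ t) #|nb v :&: nb t|.
  rewrite mulnC -sum_nat_const; apply: eq_bigr => v.
  rewrite in_setD1 in_sph => /andP[vt /eqP xv].
  by rewrite card_common //; apply: (gdist_far2 xv xt).
rewrite (sum_card_nbC sg) (big_setID (sph 3 x)) /=; congr (_ + _).
  rewrite -(card_c xt) -sum_nat_const; apply: eq_bigr => z.
  rewrite !in_dist => /andP[/eqP tz /eqP xz].
  by rewrite card_nbD1 // ?(card_b xz) // (edgeC sg) -(gdist_edge sg cg) tz.
have -> : b 4 = #|nb t :\: sph 3 x|.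
  rewrite -(@addKn (c 4) (b 4)) addnC bcE // -(card_c xt) -(card_nb t).
  by rewrite -(cardsID (sph 3 x) (nb t)) addKn.
rewrite -sum_nat_const; apply: eq_bigr => z; rewrite in_setD in_sph in_set => /andP[xz3 tz].
have xz : d x z = 5.
  have := @bipartite_edge x _ _ tz; have := edge_gdist sg cg tz.
  by met x t z; lia.
have D_5 : D = 5 by have := gdist_leD x z; lia.
rewrite card_nbD1 //; last by rewrite (edgeC sg).
rewrite (card_c xz) -(@bcE 5) ?D_5 //.
by have : b D = 0 by [case: hG => _ _ _ []]; rewrite D_5 => ->.
Qed.

Lemma card_sphE x : #|sph 4 x| * c 4 * c 3 * c 2 = k * k.-1 * b 2 * b 3.
Proof.
have h1 := card_sphS 1 x; have h2 := card_sphS 2 x; have h3 := card_sphS 3 x.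
rewrite (sph1 sg cg) card_nb triangle_free // in h1.
by rewrite -h3 h1 (mulnAC _ (c 2)) h2; lia.
Qed.

Lemma hadamard_array : D = 4 -> hadamard_graph e.
Proof.
move=> D_4; have [x [t xt]] : exists x t, d x t = 4 by apply: ex_gdist; lia.
have b40 : b 4 = 0 by case: hG => _ _ _ []; rewrite D_4.
have c4k : c 4 = k by rewrite -(@bcE 4) // b40.
have [u [y uy]] : exists u y, d u y = 2 by apply: ex_gdist; lia.
have h4 := card_sph4 xt; have hk := card_sphE x; have hw := card_far D4 uy.
have bc2 := bc2; have bc3 : b 3 + c 3 = k by apply: bcE; lia.
have b30 : 0 < b 3 by apply: b_gt0; lia.
rewrite b40 c4k mul0n addn0 in h4; rewrite c4k in hk.
have b2E : b 2 = k - c 2 by lia.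
rewrite b2E in hw hk.
have ck2 : 2 * c 2 <= k < 3 * c 2 by have := two_c2_le; lia.
have lt_c3 : k < 2 * c 3 by apply: half_lt_c; lia.
have k40 : 0 < #|sph 4 x| by apply/card_gt0P; exists t; rewrite in_sph xt.
have {}hk : #|sph 4 x| * c 3 * c 2 = k.-1 * (k - c 2) * b 3.
  have k0 : 0 < k by lia.
  by apply/eqP; rewrite -(eqn_pmul2l k0); apply/eqP; lia.
have [k2 b31] := diam4_arith ck2 lt_c3 bc3 b30 k40 hw h4 hk.
have half_k : k./2 = c 2 by rewrite k2 mul2n doubleK.
have b2c : b 2 = c 2 by lia.
have c3E : c 3 = k.-1 by lia.
have c11 : c 1 = 1 by apply: c1; lia.
exists k, b, c; rewrite half_k b31 b2c c4k c3E c11 triangle_free //; split=> //.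
  by rewrite -D_4.
by rewrite k2 mul2n odd_double.
Qed.

(** * Common neighbours with a pair at distance 2 *)

Lemma card_nb_sph2 u v z : d u v = 2 -> e v z ->
  #|nb z :&: (sph 2 u :&: sph 2 v)| = if d u z == 1 then k - 2 else (c 3).-1.
Proof.
move=> uv vz; have zv : e z v by rewrite (edgeC sg).
have dvz := edge_gdist sg cg vz; have nuz := @bipartite_edge u _ _ vz.
case: (d u z =P 1) => uz.
  (* Without triangles, every neighbour of [z] other than [u] and [v] is at distance 2 from both. *)
  have zu : e z u by rewrite (edgeC sg) -(gdist_edge sg cg) uz.
  have uNv : u != v by apply/eqP => uv0; rewrite uv0 gdistxx in uv.
  have -> : nb z :&: (sph 2 u :&: sph 2 v) = nb z :\: [set u; v].
    apply/setP=> x; rewrite in_setD in_set2 !in_setI !in_sph ![_ \in nb _]in_set.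
    have [zx|_] := boolP (e z x); last by rewrite andbF.
    rewrite andbT negb_or.
    have [->|xu] := altP (x =P u); first by rewrite gdistxx.
    have [->|xv] := altP (x =P v); first by rewrite uv gdistxx.
    by rewrite (gdist_nb2 zu zx) ?(gdist_nb2 zv zx) 1?eq_sym.
  rewrite cardsD (setIidPr _) ?cards2 ?uNv ?card_nb //.
  by apply/subsetP=> x; rewrite in_set2 in_set => /orP[]/eqP->.
have uz3 : d u z = 3 by met u v z; lia.
have -> : nb z :&: (sph 2 u :&: sph 2 v) = nb z :&: (sph 2 u :\ v).
  apply/setP=> x; rewrite !in_setI in_setD1 !in_sph [_ \in nb _]in_set.
  have [zx|_] := boolP (e z x) => //=; rewrite andbC; congr (_ && _).
  have [->|xv] := altP (x =P v); first by rewrite gdistxx.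
  by rewrite (gdist_nb2 zv zx) 1?eq_sym.
by rewrite card_nbD1 ?(card_c uz3) // in_sph uv.
Qed.

(** Counts edges from this set to [nb v], separating the [c 2] neighbours of [v] adjacent to [u]
    from the other [b 2]. *)
Lemma card_sph22 u v : d u v = 2 ->
  #|sph 2 u :&: sph 2 v| * c 2 = c 2 * (k - 2) + b 2 * (c 3).-1.
Proof.
move=> uv; have vu : d v u = 2 by rewrite (gdistC sg cg).
rewrite -{1}sum_nat_const.
transitivity (\sum_(x in sph 2 u :&: sph 2 v) #|nb x :&: nb v|).
  by apply: eq_bigr => x; rewrite !in_dist => /andP[_ /eqP vx]; rewrite setIC card_common.
rewrite (sum_card_nbC sg) (big_setID (nb u)) /=; congr (_ + _).
  rewrite -(card_common vu) -sum_nat_const; apply: eq_bigr => z.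
  by rewrite in_setI !(in_set, inE) => /andP[vz uz]; rewrite card_nb_sph2 // (gdist_edge sg cg) uz.
have -> : b 2 = #|nb v :\: nb u|.
  by rewrite cardsD card_nb (card_common vu) -bc2 addnK.
rewrite -sum_nat_const; apply: eq_bigr => z.
by rewrite in_setD !in_set => /andP[uz vz]; rewrite card_nb_sph2 // (gdist_edge sg cg) (negbTE uz).
Qed.

(** The second moment counts ordered pairs in [M] by their common neighbours in [X]: [k - 2] for an
    equal pair, and for a distinct pair all [c 2] common neighbours except [u] and [v]. *)
Lemma sum_card_common u v (M := nb u :&: nb v) (X := sph 2 u :&: sph 2 v) : d u v = 2 ->
  \sum_(x in X) #|nb x :&: M| = c 2 * (k - 2) /\
  \sum_(x in X) #|nb x :&: M| ^ 2 = c 2 * (k - 2) + c 2 * ((c 2).-1 * (c 2 - 2)).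
Proof.
move=> uv; have cM : #|M| = c 2 by apply: card_common.
have nbM m : m \in M -> [/\ e v m, d u m == 1, e m u & e m v].
  rewrite in_setI !(in_set, inE) => /andP[um vm].
  by rewrite (edgeC sg m u) (edgeC sg m v) (gdist_edge sg cg).
have cX m : m \in M -> #|nb m :&: X| = k - 2.
  by move=> /nbM[vm um _ _]; rewrite card_nb_sph2 // um.
split.
  by rewrite (sum_card_nbC sg) -cM -sum_nat_const; apply: eq_bigr => m /cX.
have uNv : u != v by apply/eqP => uv0; rewrite uv0 gdistxx in uv.
have cXX m n : m \in M -> n \in M -> m != n -> #|nb m :&: nb n :&: X| = c 2 - 2.
  move=> mM nM mn; have [_ _ mu mv] := nbM _ mM; have [_ _ nu nv] := nbM _ nM.
  have mn2 : d m n = 2 by apply: (@gdist_nb2 u) => //; rewrite (edgeC sg).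
  have -> : nb m :&: nb n :&: X = (nb m :&: nb n) :\: [set u; v].
    apply/setP=> x; rewrite in_setD in_set2 !in_setI !in_sph ![_ \in nb _]in_set.
    have [mx|_] := boolP (e m x); last by rewrite andbF.
    rewrite andbC; congr (_ && _); rewrite negb_or.
    have [->|xu] := altP (x =P u); first by rewrite gdistxx.
    have [->|xv] := altP (x =P v); first by rewrite uv gdistxx.
    by rewrite (gdist_nb2 mu mx) ?(gdist_nb2 mv mx) 1?eq_sym.
  rewrite cardsD (card_common mn2) (setIidPr _) ?cards2 ?uNv //.
  by apply/subsetP=> x; rewrite in_set2 in_setI !in_set => /orP[]/eqP->; apply/andP.
transitivity (\sum_(m in M) \sum_(n in M) #|nb m :&: nb n :&: X|).
  transitivity (\sum_(x in X) \sum_(m in M) \sum_(n in M) (e m x && e n x : nat)).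
    apply: eq_bigr => x _.
    have -> : #|nb x :&: M| = \sum_(m in M) (e m x : nat).
      rewrite -sum1_card big_mkcond [RHS]big_mkcond; apply: eq_bigr => m _.
      by rewrite in_setI in_set (edgeC sg x m); case: (e m x); case: (m \in M).
    rewrite -mulnn big_distrlr /=; apply: eq_bigr => m _; apply: eq_bigr => n _.
    by rewrite mulnb.
  rewrite exchange_big; apply: eq_bigr => m _ /=.
  rewrite exchange_big; apply: eq_bigr => n _ /=.
  rewrite -sum1_card big_mkcond [RHS]big_mkcond; apply: eq_bigr => x _.
  by rewrite !in_setI !in_set; case: (e m x); case: (e n x); case: (_ && _).
rewrite -mulnDr -{1}cM -sum_nat_const; apply: eq_bigr => m mM.
rewrite (bigD1 m) //= setIid cX //; congr (_ + _).
have -> : (c 2).-1 = #|M :\ m| by rewrite -cM [in LHS](cardsD1 m) mM.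
rewrite -sum_nat_const; apply: eq_big => n; first by rewrite in_setD1 andbC.
by case/andP=> nM nm; rewrite cXX // eq_sym.
Qed.

(** * Diameter five *)

Section Diameter5.

Hypothesis D_5 : D = 5.

(** From any neighbour of [x] both vertices are at distance 4, so [gdist_far2] applies. *)
Lemma gdist_far5 x w v : d x w = 5 -> d x v = 5 -> w != v -> d w v = 2.
Proof.
move=> xw xv; have [p] : exists p, p \in nb x.
  by apply/card_gt0P; rewrite card_nb; lia.
rewrite in_set => xp; have dxp := edge_gdist sg cg xp.
have near t : d x t = 5 -> d p t = 4.
  move=> xt; have := @bipartite_edge t _ _ xp; have := gdist_leD p t.
  by met x p t; lia.
by apply: (@gdist_far2 p); apply: near.
Qed.

Lemma card_sph5 x w : d x w = 5 -> c 2 * #|sph 5 x|.-1 = k * (b 4).-1.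
Proof.
move=> xw; have wx : w \in sph 5 x by rewrite in_sph xw.
have -> : #|sph 5 x|.-1 = #|sph 5 x :\ w| by rewrite [in LHS](cardsD1 w) wx.
rewrite mulnC -(card_nb w); apply: (edge_count sg) => [v|z].
  rewrite in_setD1 in_sph => /andP[vw /eqP xv].
  by rewrite card_common //; apply: (gdist_far5 xv xw).
rewrite in_set => wz; have xz : d x z = 4.
  have := @bipartite_edge x _ _ wz; have := edge_gdist sg cg wz; have := gdist_leD x z.
  by met x w z; lia.
by rewrite card_nbD1 ?(card_b xz) // (edgeC sg).
Qed.

Lemma ex_antipode x : exists w, d x w = 5.
Proof.
have [|w xw _] := @geodesic_extend 0 5 x x (gdistxx _ _); first lia.
by exists w.
Qed.

Lemma cube_array :
  [/\ k = 5, b 1 = 4, b 2 = 3, b 3 = 2 & b 4 = 1] /\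
  [/\ c 2 = 2, c 3 = 3, c 4 = 4, c 5 = 5 & forall x, #|sph 5 x| = 1].
Proof.
have b50 : b 5 = 0 by case: hG => _ _ _ []; rewrite D_5.
have c5k : c 5 = k by rewrite -(@bcE 5) ?D_5 // b50.
have bc4 := bcE D4; have bc3 : b 3 + c 3 = k by apply: bcE; lia.
have bc2 := bc2; have c11 : c 1 = 1 by apply: c1; lia.
have b1k := triangle_free D4 c2k.
have kc3 : k < 2 * c 3 by apply: half_lt_c; lia.
have c40 : 0 < c 4 by apply: c_gt0; lia.
have b30 : 0 < b 3 by apply: b_gt0; lia.
have b40 : 0 < b 4 by apply: b_gt0; lia.
have c20 : 0 < c 2 by apply: c_gt0; lia.
have key x : [/\ b 4 = 1, b 3 = c 2, #|sph 5 x| = 1 & #|sph 4 x| = k].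
  have [w xw] := ex_antipode x.
  have [t xt _] := @geodesic_mid _ _ sg cg 4 1 x w xw.
  have k40 : 0 < #|sph 4 x| by apply/card_gt0P; exists t; rewrite in_sph xt.
  have k50 : 0 < #|sph 5 x| by apply/card_gt0P; exists w; rewrite in_sph xw.
  apply: (diam5_arith _ bc4 c40 b30 b40 k40 k50 c20 (card_sph5 xw) (card_sph4 xt)).
    by lia.
  by rewrite card_sphS c5k.
have [u [v uv]] : exists u v, d u v = 2 by apply: ex_gdist; lia.
have [b41 b3c _ k4k] := key u.
have c3E : c 3 = k - c 2 by lia.
have [s1 s2] := sum_card_common uv.
have N := card_sph22 uv.
have := sqr_sum_leq (mem (sph 2 u :&: sph 2 v)) (fun x => #|nb x :&: (nb u :&: nb v)|).
rewrite /= s1 s2 => cauchy.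
have kE : k = c 2 + c 3 by lia.
have b2E : b 2 = c 3 by lia.
have c2gt1 : 1 < c 2 by lia.
have c3b : 0 < c 3 < 2 * c 2 by lia.
rewrite b2E kE in N; rewrite kE in cauchy.
have c22 := taut_arith c2gt1 c3b N cauchy.
(* With [c 2 = 2], the bounds [3 * c 2 <= 2 * c 3] and [c 3 < 2 * c 2] force [c 3 = 3], hence
   [k = 5]. *)
have := leq_c2_c3; split; first by split; lia.
by split; try lia; move=> x; have [] := key x.
Qed.

(** A geodesic from [v] to [z] extends to length 5 and must end at the only antipode of [v]. *)
Lemma antipode_sum v w z : d v w = 5 -> d v z + d z w = 5.
Proof.
move=> vw; have [_ [_ _ _ _ s5]] := cube_array; have leD := gdist_leD v z.
have [|t vt zt] := @geodesic_extend (d v z) (5 - d v z) v z erefl; first lia.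
have [a sa] : exists a, sph 5 v = [set a] by apply/cards1P; rewrite s5.
have sph5_a y : d v y = 5 -> y = a by move=> vy; apply/set1P; rewrite -sa in_sph vy.
suff tw : t = w by rewrite tw in zt; lia.
by rewrite (sph5_a w vw); apply: sph5_a; lia.
Qed.

Lemma card_vertices : #|T| = 32.
Proof.
have [[k5 b1 b2 b3 b4] [c2 c3 c4 c5 s5]] := cube_array.
have [x _] : exists x : T, True by have [|//|y [_ _]] := @ex_gdist 0; [lia|exists y].
have s1 : #|sph 1 x| = 5 by rewrite (sph1 sg cg) card_nb.
have h1 := card_sphS 1 x; have h2 := card_sphS 2 x; have h3 := card_sphS 3 x.
have s0 : #|sph 0 x| = 1 by rewrite (sph0 cg) cards1.
rewrite s1 b1 c2 in h1; rewrite b2 c3 in h2; rewrite b3 c4 in h3.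
transitivity (\sum_(i < 6) #|sph i x|).
  rewrite -sum1_card (partition_big (fun y => inord (d x y) : 'I_6) xpredT) //=.
  apply: eq_bigr => i _; rewrite -sum1_card; apply: eq_bigl => y.
  have := gdist_leD x y; rewrite D_5 => xy5.
  by rewrite in_sph -val_eqE /= inordK.
by rewrite !big_ord_recr big_ord0 /= s0 s1 (s5 x); lia.
Qed.

Lemma cube_c i : 0 < i <= 5 -> c i = i.
Proof.
have [[k5 b1 b2 b3 b4] [c2 c3 c4 c5 _]] := cube_array.
have c11 : c 1 = 1 by apply: c1; lia.
by case: i => [|[|[|[|[|[|i]]]]]] //; lia.
Qed.

(** * Cube coordinates from a base vertex *)

Section Coordinates.

Variable o : T.

(** The default [o] is never returned, since [nb o] has five elements. *)
Definition axis (i : 'I_5) : T := nth o (enum (nb o)) i.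

Definition coords (v : T) : {ffun 'I_5 -> bool} :=
  [ffun i => d v (axis i) < d v o].

Lemma size_nbo : size (enum (nb o)) = 5.
Proof. by rewrite -cardE card_nb; have [[->]] := cube_array. Qed.

Lemma axis_edge i : e o (axis i).
Proof.
have : axis i \in enum (nb o) by rewrite mem_nth // size_nbo.
by rewrite mem_enum in_set.
Qed.

Lemma axis_inj : injective axis.
Proof.
move=> i j /eqP; rewrite nth_uniq ?size_nbo ?enum_uniq // => /eqP ij.
exact: val_inj.
Qed.

Lemma axis_surj y : e o y -> exists i, axis i = y.
Proof.
move=> oy; have yin : y \in enum (nb o) by rewrite mem_enum in_set.
have := yin; rewrite -index_mem size_nbo => lt5.
by exists (Ordinal lt5); rewrite /axis nth_index.
Qed.

(** The axes nearer to [v] than [o] is are counted by [c (d o v)], which equals [d o v] when this is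
    positive. *)
Lemma card_coords v : #|[set i | coords v i]| = d o v.
Proof.
rewrite (gdistC sg cg); case vo : (d v o) => [|j].
  by apply: eq_card0 => i; rewrite inE ffunE vo ltn0.
have j5 : j < 5 by have := gdist_leD v o; lia.
rewrite -(@cube_c j.+1) // -(card_c vo) -(card_imset _ axis_inj).
apply: eq_card => y; apply/imsetP/idP => [[i]|].
  rewrite inE ffunE => vi ->; have := edge_gdist sg cg (axis_edge i).
  by rewrite !in_dist; met v o (axis i); lia.
rewrite in_setI in_sph in_set => /andP[/axis_surj[i <-] /eqP vi]; exists i => //.
by rewrite inE ffunE vi vo.
Qed.

Lemma coords_adj v w : e v w -> cube_adj (coords v) (coords w).
Proof.
wlog vw : v w / d o w = (d o v).+1.
  move=> hw evw; have := @bipartite_edge o _ _ evw; have := edge_gdist sg cg evw.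
  have := hw _ _ ^~ evw; have wv := evw; rewrite (edgeC sg) in wv; have := hw _ _ ^~ wv.
  rewrite /cube_adj; under eq_finset => i do rewrite eq_sym.
  by met o v w => ? ? ? ? ? ? h1 h2 ? ?; case: (ltngtP (d o v) (d o w)) => ?;
     [apply: h2|apply: h1|]; lia.
move=> evw; have dvw := edge_gdist sg cg evw.
(* Moving away from [o] keeps every true coordinate, and by [card_coords] exactly one is gained. *)
have sub : [set i | coords v i] \subset [set i | coords w i].
  apply/subsetP=> i; rewrite !inE !ffunE.
  by met v w (axis i); met o v w; lia.
rewrite /cube_adj; apply/eqP.
transitivity #|[set i | coords w i] :\: [set i | coords v i]|.
  apply: eq_card => i; have := subsetP sub i; rewrite !inE.
  by case: (coords v i); case: (coords w i) => // /(_ isT).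
by rewrite cardsD (setIidPr sub) !card_coords vw subSnn.
Qed.

Lemma coords_inj_low v w : d o v <= 2 -> coords v = coords w -> v = w.
Proof.
move=> v2 vw; have ovw : d o w = d o v by rewrite -!card_coords vw.
have at1 i j : coords v i -> d v o = j.+1 -> d v (axis i) = j /\ d w (axis i) = j.
  have := edge_gdist sg cg (axis_edge i) => oi vi vo.
  have : coords w i by rewrite -vw.
  move: vi; rewrite !ffunE.
  by met v o (axis i); met w o (axis i); met o v w; lia.
have card_v := card_coords v.
have [v0|[v1|vd2]] : d o v = 0 \/ d o v = 1 \/ d o v = 2 by lia.
- by rewrite -(gdist0_eq cg v0); apply/esym/esym; apply: (gdist0_eq cg); rewrite ovw.
- have [i] : exists i, i \in [set i | coords v i] by apply/card_gt0P; rewrite card_v v1.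
  rewrite inE => vi; have [|dv dw] := at1 i 0 vi; first by rewrite (gdistC sg cg).
  by rewrite (gdist0_eq cg dv) (gdist0_eq cg dw).
have : 1 < #|[set i | coords v i]| by rewrite card_v vd2.
case/card_gt1P=> i [j []]; rewrite !inE => vi vj ij.
have vo : d v o = 2 by rewrite (gdistC sg cg).
have [vi1 wi1] := at1 i 1 vi vo; have [vj1 wj1] := at1 j 1 vj vo.
have ij2 : d (axis i) (axis j) = 2.
  by apply: (@gdist_nb2 o); rewrite ?axis_edge // (inj_eq axis_inj).
apply/eqP; apply/negPn/negP => vNw.
(* Three common neighbours of two axes would exceed [c 2 = 2]. *)
have : #|[set o; v; w]| <= #|nb (axis i) :&: nb (axis j)|.
  apply/subset_leq_card/subsetP=> y; rewrite !in_setU !in_set1 !in_dist.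
  have oi := edge_gdist sg cg (axis_edge i); have oj := edge_gdist sg cg (axis_edge j).
  by case/orP=> [/orP[]/eqP->|/eqP->]; rewrite !(gdistC sg cg (axis _));
     rewrite ?oi ?oj ?vi1 ?vj1 ?wi1 ?wj1.
rewrite (card_common ij2) (@cube_c 2) // setUC cardsU1 cards2 in_set2.
have -> : o != v by apply/eqP => ov; rewrite -ov gdistxx in vd2.
have -> : (w == o) = false.
  by apply/eqP => wo; rewrite wo gdistxx vd2 in ovw.
by rewrite eq_sym (negbTE vNw).
Qed.

(** Vertices at distance at least 3 from [o] are replaced by their antipodes, which lie within
    distance 2 of [o] and have complementary coordinates. *)
Lemma coords_inj : injective coords.
Proof.
move=> v w vw; have ovw : d o w = d o v by rewrite -!card_coords vw.
have [|v3] := leqP (d o v) 2; first by move=> v2; apply: coords_inj_low.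
have [v' vv'] := ex_antipode v; have [w' ww'] := ex_antipode w.
have coordsN x x' : d x x' = 5 -> coords x' = [ffun i => ~~ coords x i].
  move=> xx'; apply/ffunP=> i; rewrite !ffunE.
  have := antipode_sum o xx'; have := antipode_sum (axis i) xx'.
  have := @bipartite_edge x _ _ (axis_edge i).
  by rewrite (gdistC sg cg x' o) (gdistC sg cg x' (axis i)); lia.
have v'w' : v' = w'.
  apply: coords_inj_low; last by rewrite (coordsN _ _ vv') (coordsN _ _ ww') vw.
  by have := antipode_sum o vv'; rewrite (gdistC sg cg v o); lia.
have v'v : d v' v = 5 by rewrite (gdistC sg cg).
have := antipode_sum w v'v; rewrite v'w' (gdistC sg cg w') ww' => wv.
by apply/esym/(gdist0_eq cg); lia.
Qed.

End Coordinates.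

Lemma cube_iso : graph_iso e (@cube_adj 5).
Proof.
have [o _] : exists x : T, True by have [|//|y [_ _]] := @ex_gdist 0; [lia|exists y].
have cinj := @coords_inj o; exists (coords o).
  by apply: inj_card_bij => //; rewrite card_ffun card_bool card_ord card_vertices.
move=> x y; apply/idP/idP => [|/coords_adj//].
(* Adjacency is reflected as well: the five neighbours of [x] have distinct images, which already
   exhaust the at most five cube neighbours. *)
have : [set coords o z | z in nb x] = [set g | cube_adj (coords o x) g].
  apply/eqP; rewrite eqEcard; apply/andP; split.
    by apply/subsetP=> _ /imsetP[z + ->]; rewrite !in_set => /coords_adj.
  rewrite card_imset // card_nb; have [[-> _ _ _ _] _] := cube_array.
  exact: card_cube_nb.
move/setP/(_ (coords o y)); rewrite in_set => <- /imsetP[z xz /cinj->].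
by rewrite in_set in xz.
Qed.

End Diameter5.
End LargeC2.

End DistanceRegular.

Theorem theorem2 (T : finType) (e : rel T) (D : nat) (b c : nat -> nat)
    (hG : distance_regular e D b c) (hk : 3 <= b 0) (hD : D = 4 \/ D = 5) :
  3 * c 2 <= b 0 \/
  ((D = 4 /\ hadamard_graph e) \/ (D = 5 /\ graph_iso e (@cube_adj 5))).
Proof.
have [le_c2|lt_c2] := leqP (3 * c 2) (b 0); first by left.
right; have D4 : 4 <= D by lia.
have D5 : D <= 5 by lia.
case: hD => hD; [left|right]; split=> //.
  exact: (hadamard_array hG D4 D5 hk lt_c2 hD).
exact: (cube_iso hG D4 D5 hk lt_c2 hD).
Qed.
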